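(* Let $[a,b]$ be an interval and $S$ a finite set of sensors with coverage intervals $[u_s,v_s]$. Suppose continuous OGA (defined in the context) was applied to select a set $S^{\mathrm{old}}\subseteq S$ covering $[a,b]$, and then exactly one sensor $s^*\in S^{\mathrm{old}}$ fails, producing a single gap $[u_G,v_G]$ (the part of $s^*$'s interval no longer covered by $S^{\mathrm{old}}\setminus\{s^*\}$). Assume $S\setminus\{s^*\}$ still covers $[a,b]$. Let $n_{OGA}$ be the number of sensors selected by a new run of continuous OGA on $[a,b]$ using $S\setminus\{s^*\}$, and let $n_{LOGM}$ be the number of sensors in the solution produced by LOGM (defined in the context). Then $n_{OGA}\le n_{LOGM}\le n_{OGA}+1$.
   Context: Continuous OGA for covering $[\alpha,\beta]$: set the current point $p=\alpha$; repeatedly select, among the available not-yet-selected sensors whose interval contains $p$, one with the largest right endpoint (ties broken in favor of the longest interval), and set $p$ to that right endpoint; stop once $p\ge\beta$. LOGM (locally optimal gap mending): keep all sensors of $S^{\mathrm{old}}\setminus\{s^*\}$, and additionally run continuous OGA on the gap $[u_G,v_G]$, starting from $u_G$ and stopping once $v_G$ is covered, using only the sensors of $S$ that were not in $S^{\mathrm{old}}$; the LOGM solution is the union of the kept and newly selected sensors.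
   Formalization: The gap is taken inside [a,b], as the closure of the part of s*'s interval within [a,b] that the other old sensors leave uncovered; if s* extends beyond [a,b] and the gap is not restricted this way, the bound can fail. *)

(* Defs.v *)
From HB Require Import structures.
From mathcomp Require Import all_boot all_order all_algebra.
From mathcomp Require Import all_classical all_reals topology normedtype.
Import Order.TTheory GRing.Theory Num.Theory.
Import numFieldNormedType.Exports.

Set Implicit Arguments.
Unset Strict Implicit.
Unset Printing Implicit Defensive.

Local Open Scope ring_scope.

(* Sensors are the elements of a finite type T, so that distinct sensors may
   have the same coverage interval [u s, v s]. *)
Section Sensors.
Context {R : realType} {T : finType} (u v : T -> R).

Definition coverage (s : T) : set R := `[u s, v s]%classic.

Definition covered (A : {set T}) : set R :=
  (\bigcup_(s in [set` A]) coverage s)%classic.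

Definition covers (A : {set T}) (a b : R) : Prop :=
  (`[a, b] `<=` covered A)%classic.

(* At equal right endpoints the longest interval is preferred; sensors with
   identical intervals are left undetermined, hence a relation. *)
Definition greedy_choice (A : {set T}) (p : R) (s : T) : Prop :=
  [/\ s \in A, coverage s p &
      forall t, t \in A -> coverage t p ->
        v t < v s \/ v t = v s /\ v t - u t <= v s - u s].

(* [oga A p beta X]: some run of continuous OGA with current point p, target
   endpoint beta and available not-yet-selected sensors A selects exactly the
   set X from then on; a run for covering [alpha, beta] starts at p = alpha.
   [oga_stuck] makes runs total: the algorithm halts without reaching beta when
   no available sensor contains p, so that the success of a run is nowhere
   assumed.  This never happens when A covers [p, beta]. *)
Inductive oga : {set T} -> R -> R -> {set T} -> Prop :=
| oga_stop (A : {set T}) p beta : beta <= p -> oga A p beta finset.set0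
| oga_stuck (A : {set T}) p beta : p < beta ->
    (forall s, s \in A -> ~ coverage s p) -> oga A p beta finset.set0
| oga_step (A : {set T}) p beta s (X : {set T}) : p < beta -> greedy_choice A p s ->
    oga (A :\ s) (v s) beta X -> oga A p beta (s |: X).

(* The part of [a, b] in the interval of sstar left uncovered by the other
   sensors of Sold lacks the endpoints it shares with those sensors; the gap
   [uG, vG] is its closure.  Restricting to [a, b] matters only when sstar
   sticks out of [a, b]. *)
Definition is_gap (a b : R) (Sold : {set T}) (sstar : T) (uG vG : R) : Prop :=
  uG <= vG /\
  closure (`[a, b] `&` (coverage sstar `\` covered (Sold :\ sstar)))%classic
    = `[uG, vG]%classic.

Definition logm (S Sold : {set T}) (sstar : T) (uG vG : R) (X : {set T})
    : Prop :=
  exists2 F : {set T}, oga (S :\: Sold) uG vG F & X = (Sold :\ sstar) :|: F.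

End Sensors.

(* Main.v *)
(** Say that a sensor right-covers [x] when [u <= x < v]. A greedy run that
    progresses visits current points [p_0 < p_1 < ...], one per selected sensor,
    and no available sensor right-covers two of them, since a sensor containing
    [p_j] ends at or before [p_(j+1)]. So the visited points bound from below the
    size of every cover by available sensors, which gives [n_OGA <= n_LOGM].

    For the other inequality, let [s] be the failed sensor. Take the points of the
    old run, except the point [c] at which [s] was selected and the point [v s]
    that followed, together with the points of the mending run. The gap lies
    between [c] and [v s], whereas a sensor that right-covers a remaining old point
    lies left of [c] or right of [v s]. So no sensor that is still alive
    right-covers two of these points, and every cover has at least
    [(n_old - 2) + n_mend >= n_LOGM - 1] elements. *)
Require Import Defs.
From HB Require Import structures.
From mathcomp Require Import all_boot all_order all_algebra.
From mathcomp Require Import all_classical all_reals topology normedtype.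
Import Order.TTheory GRing.Theory Num.Theory.
Import numFieldNormedType.Exports.
Local Open Scope ring_scope.

(** * Right coverage and the packing bound *)

Section RightCoverage.
Set Implicit Arguments.
Unset Strict Implicit.
Unset Printing Implicit Defensive.
Context {R : realType} {T : finType} (u v : T -> R).
Implicit Types (A X : {set T}) (s t : T) (p x y : R).

(** Half-open because a selected sensor ends exactly at the next visited point; with closed
    intervals it would contain both. *)
Definition rcov1 t x := u t <= x < v t.

Definition rcovers A p beta :=
  forall x, p <= x < beta -> exists2 t, t \in A & rcov1 t x.

Definition packing A (ps : seq R) :=
  forall t x y, t \in A -> x \in ps -> y \in ps ->
    rcov1 t x -> rcov1 t y -> x = y.

(** Sending each point to a sensor of [A] that right-covers it is injective, by the packing
    condition. *)
Lemma packing_leq A (ps : seq R) :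
  uniq ps -> packing A ps ->
  (forall x, x \in ps -> exists2 t, t \in A & rcov1 t x) ->
  (size ps <= #|A|)%N.
Proof.
move=> ups pack cov; pose f x := [pick t in A | rcov1 t x].
have fP x : x \in ps -> exists t, [/\ f x = Some t, t \in A & rcov1 t x].
  move=> /cov[t tA tx]; rewrite /f; case: pickP => [t' /andP[? ?]|/(_ t)].
    by exists t'.
  by rewrite tA tx.
rewrite cardE -(size_map f) -(size_map (@Some T) (enum A)); apply: uniq_leq_size.
  rewrite map_inj_in_uniq// => x y xps yps.
  have [t [-> tA tx]] := fP _ xps; have [t' [-> _ ty]] := fP _ yps.
  by case=> tt'; apply: (pack t) => //; rewrite tt'.
move=> _ /mapP[x /fP[t [-> tA _]] ->].
by rewrite map_f// mem_enum.
Qed.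

Lemma uncovered_right A x beta : x < beta ->
  (forall t, t \in A -> ~~ rcov1 t x) ->
  (* The witness [z] is the least left endpoint beyond [x], capped at [beta]: a sensor containing
     some [y] in between would start at or before [x] and so right-cover [x]. *)
  exists2 z, x < z <= beta & forall y, x < y < z -> ~ covered u v A y.
Proof.
move=> xb nA; exists (\big[Num.min/beta]_(t in A | x < u t) u t).
  apply/andP; split; last exact: bigmin_le_id.
  by apply/bigmin_gtP; split => // t /andP[].
move=> y /andP[xy yz] [t /= tA]; rewrite /coverage/= in_itv/= => /andP[ut tv].
have := nA _ tA; rewrite /rcov1 (lt_le_trans xy tv) andbT -ltNge => xu.
move: yz => /bigmin_gtP[_ /(_ t)]; rewrite tA xu => /(_ isT).
by rewrite ltNge ut.
Qed.

Lemma covers_rcovers A a b : covers u v A a b -> rcovers A a b.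
Proof.
move=> cA x /andP[ax xb].
have [[t tA tx]|nA] := pselect (exists2 t, t \in A & rcov1 t x).
  by exists t.
have [|z /andP[xz zb] zP] := @uncovered_right A x b xb.
  by move=> t tA; apply/negP => tx; apply: nA; exists t.
case: (zP ((x + z) / 2)); first by rewrite !midf_lt.
apply: cA; rewrite /= in_itv/= (le_trans ax) ?midf_le ?(ltW xz)//=.
by rewrite (le_trans _ zb)// midf_le// ltW.
Qed.

(** * Greedy runs and their visited points *)

Lemma rcovers_greedy A p beta s : p < beta -> rcovers A p beta ->
  greedy_choice u v A p s ->
  [/\ s \in A, u s <= p < v s, rcovers (A :\ s) (v s) beta &
      forall t x, t \in A -> v s <= x -> rcov1 t x -> p < u t].
Proof.
move=> pb cA [sA sp smax].
have smaxv t : t \in A -> u t <= p <= v t -> v t <= v s.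
  move=> tA tp; have /= := smax t tA; rewrite /coverage/= in_itv/= => /(_ tp).
  by case=> [/ltW //|[-> _]].
(* Right coverage at [p] provides a sensor ending strictly beyond [p], so the run progresses. *)
have ps : p < v s.
  have [|t tA /andP[ut pt]] := cA p; first by rewrite lexx.
  by rewrite (lt_le_trans pt)// smaxv// ut ltW.
split=> //.
- by move: sp; rewrite /coverage/= in_itv/= => /andP[-> _].
- move=> x /andP[sx xb]; have [|t tA tx] := cA x.
    by rewrite xb andbT (le_trans (ltW ps)).
  exists t => //; rewrite in_setD1 tA andbT; apply/eqP => ts; move: tx.
  by rewrite /rcov1 ts [x < _]ltNge sx andbF.
- move=> t x tA sx /andP[ut xt]; rewrite ltNge; apply/negP => utp.
  have := smaxv t tA; rewrite utp (ltW (lt_trans ps (le_lt_trans sx xt))).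
  by move=> /(_ isT); rewrite leNgt (le_lt_trans sx xt).
Qed.

(* [pivot A X ps p s c]: [c] is the current point at which the run selects [s]. *)
Definition pivot A X (ps : seq R) p s c :=
  [/\ p <= c, c \in ps, rcovers (X :\ s) p c &
      forall t x, t \in A -> x \in ps -> x != c -> x != v s -> rcov1 t x ->
        v t <= c \/ v s < u t].

(** Induction on the run. The clause [x = p \/ p < u t] feeds the pivot clause: for the run
    continuing from [v s], it puts any sensor that right-covers a later point other than [v s] to
    the right of [v s]. *)
Lemma oga_points A p beta X : oga u v A p beta X -> rcovers A p beta ->
  [/\ X \subset A, rcovers X p beta & exists ps : seq R,
    [/\ size ps = #|X| /\ uniq ps,
        (forall x, x \in ps -> p <= x < beta),
        packing A ps,
        (forall t x, t \in A -> x \in ps -> rcov1 t x -> x = p \/ p < u t) &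
        forall s, s \in X -> exists c, pivot A X ps p s c]].
Proof.
elim=> {A p beta X}.
- move=> A p beta bp cA; split; first exact: finset.sub0set.
    by move=> x /andP[px xb]; move: (le_lt_trans px xb); rewrite ltNge bp.
  by exists [::]; rewrite cards0; split=> // s; rewrite finset.in_set0.
- move=> A p beta pb nA cA; have [|t tA /andP[ut pt]] := cA p.
    by rewrite lexx.
  by case: (nA t tA); rewrite /coverage/= in_itv/= ut ltW.
move=> A p beta s X pb gs _ IH cA.
have [sA /andP[us ps] cAs sfar] := rcovers_greedy pb cA gs.
have [XA cX [qs [[szqs uqs] qs_itv pack qhead qpiv]]] := IH cAs.
have sX : s \notin X.
  by apply/negP => /(fintype.subsetP XA); rewrite !inE eqxx.
have pltq x : x \in qs -> p < x.
  by move=> /qs_itv/andP[sx _]; apply: lt_le_trans sx.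
have pqs : p \notin qs by apply/negP => /pltq; rewrite ltxx.
have tAs t x : t \in A -> x \in qs -> rcov1 t x -> t \in A :\ s.
  move=> tA /qs_itv/andP[sx _] /andP[_ xt]; rewrite in_setD1 tA andbT.
  by apply/eqP => ts; move: xt; rewrite ts ltNge sx.
have far t x : t \in A -> x \in qs -> rcov1 t x -> p < u t.
  by move=> tA /qs_itv/andP[sx _]; apply: sfar.
split.
- by rewrite finset.subUset finset.sub1set sA (fintype.subset_trans XA)// finset.subD1set.
- move=> x /andP[px xb]; have [xs|sx] := ltP x (v s).
    by exists s; rewrite ?setU11// /rcov1 xs (le_trans us px).
  have [|t tX tx] := cX x; first by rewrite sx.
  by exists t => //; rewrite in_setU1 tX orbT.
exists (p :: qs); split.
- by rewrite /= szqs cardsU1 sX pqs.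
- by move=> x; rewrite inE => /predU1P[->|xq];
    [rewrite lexx|rewrite ltW ?pltq//; case/andP: (qs_itv _ xq)].
- move=> t x y tA; rewrite !inE => /predU1P[->|xq] /predU1P[->|yq] // tx ty.
  + by case/andP: tx => utp _; have := far _ _ tA yq ty; rewrite ltNge utp.
  + by case/andP: ty => utp _; have := far _ _ tA xq tx; rewrite ltNge utp.
  + exact: (pack t) (tAs _ _ tA xq tx) xq yq tx ty.
- move=> t x tA; rewrite inE => /predU1P[->|xq] tx; first by left.
  by right; apply: far xq tx.
move=> s'; rewrite in_setU1 => /predU1P[->|s'X].
  exists p; split=> //; first exact: mem_head.
    by move=> x /andP[px /(le_lt_trans px)]; rewrite ltxx.
  move=> t x tA; rewrite inE => /predU1P[->|xq]; first by rewrite eqxx.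
  move=> _ xs tx; right.
  have [xs'|//] := qhead t x (tAs _ _ tA xq tx) xq tx.
  by rewrite xs' eqxx in xs.
have [c [sc cq cXc cfar]] := qpiv s' s'X.
have ss' : s != s' by apply: contraNneq sX => ->.
exists c; split.
- by rewrite (le_trans (ltW ps)).
- by rewrite inE cq orbT.
- move=> x /andP[px xc]; have [xs|sx] := ltP x (v s).
    by exists s; rewrite ?in_setD1 ?ss' ?setU11// /rcov1 xs (le_trans us px).
  have [|t] := cXc x; first by rewrite sx.
  rewrite in_setD1 => /andP[ts' tX] tx.
  by exists t => //; rewrite in_setD1 ts' in_setU1 tX orbT.
- move=> t x tA; rewrite inE => /predU1P[->|xq] xc xs' tx; last first.
    exact: cfar (tAs _ _ tA xq tx) xq xc xs' tx.
  (* Otherwise [t] contains [p] and ends beyond [c], hence beyond [v s], contrary to the greedy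
     choice of [s]. *)
  left; rewrite leNgt; apply/negP => ct.
  case/andP: (tx) => ut _.
  have := sfar t (v s) tA (lexx _).
  rewrite /rcov1 (le_lt_trans sc ct) (le_trans ut (ltW ps)) => /(_ isT).
  by rewrite ltNge ut.
Qed.

(** * The gap as a closure *)

Section Gap.
Context (a b : R) (Sold : {set T}) (sstar : T) (uG vG : R).
Hypothesis hgap : is_gap u v a b Sold sstar uG vG.

Let W := (`[a, b] `&` (coverage u v sstar `\` covered u v (Sold :\ sstar)))%classic.

Lemma gap_itv (c d : R) : (W `<=` `[c, d])%classic -> c <= uG /\ vG <= d.
Proof.
case: hgap => uv clW Wcd.
have sub : (`[uG, vG] `<=` `[c, d])%classic.
  rewrite -clW; move/closure_id: (@interval_closed R (BLeft c) (BRight d) isT isT) => ->.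
  exact: closureS.
split.
- have := sub uG; rewrite /= !in_itv/= lexx uv => /(_ isT).
  by case/andP.
- have := sub vG; rewrite /= !in_itv/= lexx uv => /(_ isT).
  by case/andP.
Qed.

Lemma gap_not_rcov x t : uG <= x < vG -> t \in Sold :\ sstar -> ~~ rcov1 t x.
Proof.
case: hgap => uv clW /andP[ux xv] tS; apply/negP => /andP[ut xt].
have xm : x < Num.min (v t) vG by rewrite lt_min xt.
(* This point lies in the closure of [W], yet has a neighbourhood covered by [t]. *)
pose y := (x + Num.min (v t) vG) / 2.
have : closure W y.
  rewrite clW /= in_itv/= (le_trans ux) ?midf_le ?ltW//=.
  by rewrite (lt_le_trans (midf_lt xm).2)// ge_min lexx orbT.
move=> /(_ `]x, (Num.min (v t) vG)[%classic)[].
  by apply: near_in_itvoo; rewrite in_itv/= !midf_lt.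
move=> z [[_ [_ nz]]]; rewrite /= in_itv/= lt_min => /andP[xz /andP[zt _]].
apply: nz; exists t => //; rewrite /coverage/= in_itv/= (ltW zt) andbT.
by rewrite (le_trans ut)// ltW.
Qed.

(** The point [x] may itself be outside [W], as the right endpoint of a survivor, but the points
    just to its right are in [W], which forces both bounds. *)
Lemma mem_gap x : rcovers Sold a b -> a <= x < b ->
  (forall t, t \in Sold :\ sstar -> ~~ rcov1 t x) -> uG <= x < vG.
Proof.
case: hgap => uv clW cS axb nx; have [t tS tx] := cS x axb.
have /eqP ts : t == sstar.
  by apply/negPn/negP => ts; have := nx t; rewrite in_setD1 ts tS tx => /(_ isT).
move: axb => /andP[ax xb]; move: tx; rewrite ts => /andP[sx xs].
have [|z /andP[xz]] := @uncovered_right (Sold :\ sstar) x (Num.min b (v sstar)) _ nx.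
  by rewrite lt_min xb.
rewrite le_min => /andP[zb zs] zP.
have Gy y : x < y < z -> uG <= y <= vG.
  move=> /[dup] /zP ny /andP[xy yz].
  have : closure W y.
    apply: subset_closure; split.
      by rewrite /= in_itv/= (le_trans ax (ltW xy)) (le_trans (ltW yz)).
    split=> //; rewrite /coverage/= in_itv/= (le_trans sx (ltW xy)).
    by rewrite (le_trans (ltW yz)).
  by rewrite clW /= in_itv.
apply/andP; split; last first.
  have /Gy/andP[_] : x < (x + z) / 2 < z by rewrite !midf_lt.
  by apply: lt_le_trans; rewrite midf_lt.
rewrite leNgt; apply/negP => xu.
have xm : x < Num.min uG z by rewrite lt_min xu.
have := midf_lt xm; rewrite lt_min => -[xy /andP[yu yz]].
by have := Gy _ (introT andP (conj xy yz)); rewrite leNgt yu.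
Qed.

End Gap.
End RightCoverage.

Theorem theorem5 (R : realType) (T : finType) (u v : T -> R) (a b : R)
    (S Sold : {set T}) (sstar : T) (uG vG : R) (Snew Slogm : {set T})
    (hab : a <= b)
    (huv : forall s : T, s \in S -> u s <= v s)
    (hSold : Sold \subset S)
    (hold : oga u v S a b Sold)
    (hcov_old : covers u v Sold a b)
    (hstar : sstar \in Sold)
    (hgap : is_gap u v a b Sold sstar uG vG)
    (hcov : covers u v (S :\ sstar) a b)
    (hnew : oga u v (S :\ sstar) a b Snew)
    (hlogm : logm u v S Sold sstar uG vG Slogm) :
  (#|Snew| <= #|Slogm| <= #|Snew| + 1)%N.
Proof.
have cS' := covers_rcovers hcov.
have cS : rcovers u v S a b.
  by move=> x /cS'[t]; rewrite in_setD1 => /andP[_ tS] tx; exists t.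
have [_ cSold [ps [[szps ups] ps_itv packp _ pivp]]] := oga_points hold cS.
have [c [ac cps cSc cfar]] := pivp _ hstar.
have [subN cN [ns [[szns uns] ns_itv packn _ _]]] := oga_points hnew cS'.
have [aG Gb] : a <= uG /\ vG <= b by apply: (gap_itv hgap) => y [].
(* Left of [c] the other sensors of [Sold] already cover, and [W] lies inside the interval of
   [sstar]. *)
have [cG Gs] : c <= uG /\ vG <= v sstar.
  apply: (gap_itv hgap) => y [+ [+ ny]].
  rewrite /coverage/= !in_itv/= => /andP[ay yb] /andP[_ ->].
  rewrite andbT leNgt; apply/negP => yc; apply: ny.
  have [|t tS /andP[ut yt]] := cSc y; first by rewrite ay.
  by exists t => //; rewrite /coverage/= in_itv/= ut ltW.
have alive x t : uG <= x < vG -> t \in S :\ sstar -> rcov1 u v t x ->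
    t \in S :\: Sold.
  move=> xG; rewrite !inE => /andP[ts tS] tx; rewrite tS andbT.
  apply: contraTN tx => tSold.
  by apply: (gap_not_rcov hgap) => //; rewrite !inE ts.
have cG' : rcovers u v (S :\: Sold) uG vG.
  move=> x /[dup] xG /andP[ux xv].
  have [|t tS tx] := cS' x; first by rewrite (le_trans aG) ?(lt_le_trans xv).
  by exists t => //; apply: alive tx.
case: hlogm => F hF ->.
have [subF cF [qs [[szqs uqs] qs_itv packq _ _]]] := oga_points hF cG'.
apply/andP; split.
  rewrite -szns; apply: packing_leq => //.
    move=> t x y tL; apply: packn; move: tL; rewrite !inE.
    case/orP=> [/andP[-> /(fintype.subsetP hSold)->]//|].
    move=> /(fintype.subsetP subF); rewrite !inE => /andP[tS ->].
    by rewrite andbT; apply: contraNneq tS => ->.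
  move=> x /ns_itv xab.
  (* A visited point missed by the kept sensors lies in the gap, where [F] right-covers it. *)
  have [[t tS tx]|nx] := pselect (exists2 t, t \in Sold :\ sstar & rcov1 u v t x).
    by exists t => //; rewrite finset.in_setU tS.
  have [|t tF tx] := cF x; last by exists t => //; rewrite finset.in_setU tF orbT.
  apply: (mem_gap hgap cSold xab) => t tS; apply/negP => tx.
  by apply: nx; exists t.
(* If [v sstar] is at or beyond [b], it is not in [ps] and its [rem] removes nothing. *)
pose rs := rem c (rem (v sstar) ps).
have rsP x : x \in rs -> [/\ x \in ps, x != c & x != v sstar].
  by rewrite mem_rem_uniq ?rem_uniq// !inE mem_rem_uniq// !inE => /and3P[].
have sz_rem (x : R) (l : seq R) : (size l <= (size (rem x l)).+1)%N.
  by have [/size_rem ->|/rem_id ->] := boolP (x \in l); rewrite ?leqSpred.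
have disj t x y : t \in S -> x \in rs -> y \in qs ->
    rcov1 u v t x -> rcov1 u v t y -> False.
  move=> tS /rsP[xps xc xs] /qs_itv/andP[Gy yG] tx /andP[ut yt].
  have [vc|su] := cfar t x tS xps xc xs tx.
    by move: (lt_le_trans yt vc); rewrite ltNge (le_trans cG Gy).
  by move: (lt_trans (lt_le_trans su ut) yG); rewrite ltNge Gs.
have inS t : t \in Snew -> t \in S :\ sstar by exact: (fintype.subsetP subN).
have inS1 t : t \in Snew -> t \in S by move=> /inS; rewrite in_setD1 => /andP[].
have covN x : x \in rs ++ qs -> exists2 t, t \in Snew & rcov1 u v t x.
  rewrite mem_cat => /orP[/rsP[xps _ _]|/qs_itv/andP[ux xv]]; apply: cN; last first.
    by rewrite (le_trans aG) ?(lt_le_trans xv).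
  exact: ps_itv.
have szle : (size (rs ++ qs) <= #|Snew|)%N.
  apply: packing_leq (covN).
    rewrite cat_uniq !rem_uniq// uqs andbT; apply/hasPn => x xq.
    apply/negP => xr.
    have [|t tN tx] := covN x; first by rewrite mem_cat xr.
    exact: (disj t x x (inS1 _ tN)).
  move=> t x y tN; rewrite !mem_cat => /orP[xr|xq] /orP[yr|yq] tx ty.
  - have [xps _ _] := rsP _ xr; have [yps _ _] := rsP _ yr.
    exact: packp (inS1 _ tN) xps yps tx ty.
  - by case: (disj t x y (inS1 _ tN)).
  - by case: (disj t y x (inS1 _ tN)).
  - exact: packq (alive _ _ (qs_itv _ xq) (inS _ tN) tx) xq yq tx ty.
rewrite (leq_trans (leq_card_setU _ _))// -szqs.
have := cardsD1 sstar Sold; rewrite hstar -szps add1n => szold.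
(* [Sold :\ sstar] has one element fewer than [ps], and [rs] at most two fewer: the difference is
   the [+ 1] of the bound. *)
have le1 : (#|Sold :\ sstar| <= (size rs).+1)%N.
  by rewrite -ltnS -szold (leq_trans (sz_rem (v sstar) ps)) // ltnS sz_rem.
rewrite addn1 (leq_trans (leq_add le1 (leqnn _)))// addSn ltnS.
by rewrite -size_cat.
Qed.
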